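(* Let $o\in\{1,\dots,n\}$. Then $(\mathbf{x}_o,\mathbf{y}_o)\in E$ (that is, $\mathrm{DMU}_o$ is extreme efficient) if and only if the following system in the unknowns $\boldsymbol{\delta}\in\mathbb{R}^{n-1}$, $\mathbf{t}^-\in\mathbb{R}^m$, $\mathbf{t}^+\in\mathbb{R}^s$ is infeasible: $$-\mathbf{X}_o\boldsymbol{\delta}+(\mathbf{1}_{n-1}^T\boldsymbol{\delta})\mathbf{x}_o\geqq\mathbf{t}^-,\quad \mathbf{Y}_o\boldsymbol{\delta}-(\mathbf{1}_{n-1}^T\boldsymbol{\delta})\mathbf{y}_o\geqq\mathbf{t}^+,\quad \mathbf{1}_{n-1}^T\boldsymbol{\delta}\ge 1,\quad \boldsymbol{\delta}\geqq\mathbf{0}_{n-1},\quad \mathbf{1}_m\geqq\mathbf{t}^-\geqq\mathbf{0}_m,\quad \mathbf{1}_s\geqq\mathbf{t}^+\geqq\mathbf{0}_s.$$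
   Context: There are $n$ observed decision making units; $\mathrm{DMU}_j$ has input vector $\mathbf{x}_j\in\mathbb{R}_+^m$ and output vector $\mathbf{y}_j\in\mathbb{R}_+^s$ (nonnegative entries). $\mathbf{X}=[\mathbf{x}_1\ \dots\ \mathbf{x}_n]$, $\mathbf{Y}=[\mathbf{y}_1\ \dots\ \mathbf{y}_n]$; $\mathbf{X}_o,\mathbf{Y}_o$ are obtained from them by deleting the columns $\mathbf{x}_o$, $\mathbf{y}_o$. For vectors, $\mathbf{u}\geqq\mathbf{v}$ means $u_j\ge v_j$ for all $j$; $\mathbf{u}\geq\mathbf{v}$ means $\mathbf{u}\geqq\mathbf{v}$ and $\mathbf{u}\ne\mathbf{v}$. $\mathbf{1}_d,\mathbf{0}_d$ are the all-ones and all-zeros vectors in $\mathbb{R}^d$. $T^{DEA}=\{(\mathbf{x},\mathbf{y})\in\mathbb{R}_+^m\times\mathbb{R}_+^s \mid \mathbf{x}\geqq\mathbf{X}\boldsymbol{\lambda},\ \mathbf{Y}\boldsymbol{\lambda}\geqq\mathbf{y},\ \mathbf{1}_n^T\boldsymbol{\lambda}=1,\ \boldsymbol{\lambda}\geqq\mathbf{0}_n\text{ for some }\boldsymbol{\lambda}\}$. $\mathrm{DMU}_o$ is strongly efficient (in the Pareto sense, equivalently in the BCC sense) iff there is no $(\mathbf{x},\mathbf{y})\in T^{DEA}$ with $\begin{pmatrix}-\mathbf{x}\\ \mathbf{y}\end{pmatrix}\geq\begin{pmatrix}-\mathbf{x}_o\\ \mathbf{y}_o\end{pmatrix}$. $E$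 (extreme efficient) is the set of strongly efficient DMUs that cannot be represented as a convex combination of the remaining DMUs. *)

(* Defs.v *)
From mathcomp Require Import all_boot all_order all_algebra.
From mathcomp Require Import reals.

Set Implicit Arguments.
Unset Strict Implicit.
Unset Printing Implicit Defensive.

Import Order.TTheory GRing.Theory Num.Theory.

Local Open Scope ring_scope.

Definition vgeqq (R : realType) (d : nat) (u v : 'cV[R]_d) : Prop :=
  forall i, v i 0 <= u i 0.

Definition vgeq (R : realType) (d : nat) (u v : 'cV[R]_d) : Prop :=
  vgeqq u v /\ u <> v.

Notation "u >=v v" := (vgeqq u v) (at level 70, no associativity) : ring_scope.
Notation "u >=/=v v" := (vgeq u v) (at level 70, no associativity) : ring_scope.

Definition ones (R : realType) (d : nat) : 'cV[R]_d := const_mx 1.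
Arguments ones {R d}.

(* The scalar 1_d^T u. *)
Definition sumv (R : realType) (d : nat) (u : 'cV[R]_d) : R := \sum_i u i 0.

(* The data are the columns of X and Y: DMU_j is (col j X, col j Y). *)
Definition TDEA (R : realType) (m s n : nat)
    (X : 'M[R]_(m, n)) (Y : 'M[R]_(s, n)) (x : 'cV[R]_m) (y : 'cV[R]_s) : Prop :=
  (x >=v 0) /\ (y >=v 0) /\
  exists lambda : 'cV[R]_n,
    [/\ x >=v X *m lambda, Y *m lambda >=v y, sumv lambda = 1
      & lambda >=v 0].

Definition strongly_efficient (R : realType) (m s n : nat)
    (X : 'M[R]_(m, n)) (Y : 'M[R]_(s, n)) (o : 'I_n) : Prop :=
  ~ exists x y, TDEA X Y x y /\
      (col_mx (- x) y >=/=v col_mx (- col o X) (col o Y)).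

(* col' o deletes column o.  DMUs are identified by their index, so another DMU
   with the same data as DMU_o counts among the remaining ones. *)
Definition convex_comb_of_remaining (R : realType) (m s n : nat)
    (X : 'M[R]_(m, n)) (Y : 'M[R]_(s, n)) (o : 'I_n) : Prop :=
  exists mu : 'cV[R]_n.-1,
    [/\ mu >=v 0, sumv mu = 1, col o X = col' o X *m mu
      & col o Y = col' o Y *m mu].

Definition extreme_efficient (R : realType) (m s n : nat)
    (X : 'M[R]_(m, n)) (Y : 'M[R]_(s, n)) (o : 'I_n) : Prop :=
  strongly_efficient X Y o /\ ~ convex_comb_of_remaining X Y o.

(* Main.v *)
Require Import Defs.
From mathcomp Require Import all_boot all_order all_algebra.
From mathcomp Require Import reals.

Set Implicit Arguments.
Unset Strict Implicit.
Unset Printing Implicit Defensive.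

Import Order.TTheory GRing.Theory Num.Theory.

Local Open Scope ring_scope.

(** Dividing [delta] by its sum shows that the system is feasible iff some
  convex combination of the remaining DMUs weakly dominates DMU_o.  Such a
  combination either equals DMU_o or shows that DMU_o is not strongly
  efficient.  Conversely, if [lambda] yields a point dominating DMU_o, then
  [lambda_o < 1], since otherwise that point would be DMU_o itself; moving the
  term [lambda_o (x_o, y_o)] to the other side and dividing by [1 - lambda_o]
  leaves a combination of the remaining DMUs. *)

Definition dominated_by_remaining (R : realType) (m s n : nat)
    (X : 'M[R]_(m, n)) (Y : 'M[R]_(s, n)) (o : 'I_n) : Prop :=
  exists mu : 'cV[R]_n.-1,
    [/\ mu >=v 0, sumv mu = 1, col o X >=v col' o X *m mu
      & col' o Y *m mu >=v col o Y].

Section OrderedVectors.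
Variables (R : realType) (d : nat).
Implicit Types (u v : 'cV[R]_d) (a : R).

Lemma sumv_ge0 u : u >=v 0 -> 0 <= sumv u.
Proof. by move=> u0; apply: sumr_ge0 => i _; have := u0 i; rewrite mxE. Qed.

Lemma sumvZ a u : sumv (a *: u) = a * sumv u.
Proof. by rewrite /sumv mulr_sumr; apply: eq_bigr => i _; rewrite mxE. Qed.

Lemma sumv_eq0 u : u >=v 0 -> sumv u = 0 -> u = 0.
Proof.
move=> u0 /eqP; rewrite psumr_eq0 => [|i _]; last first.
  by have := u0 i; rewrite mxE.
move=> /allP ui0; apply/colP => i; rewrite mxE; apply/eqP/ui0.
by rewrite mem_index_enum.
Qed.

Lemma vgeqq_trans v u w : u >=v v -> v >=v w -> u >=v w.
Proof. by move=> uv vw i; apply: le_trans (uv i). Qed.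

Lemma vgeqq_anti u v : u >=v v -> v >=v u -> u = v.
Proof. by move=> uv vu; apply/colP => i; apply/le_anti; rewrite vu uv. Qed.

Lemma vgeqqZ a u v : 0 <= a -> u >=v v -> a *: u >=v a *: v.
Proof. by move=> a0 uv i; rewrite !mxE ler_wpM2l. Qed.

Lemma vgeqqZ_ge0 a u : 0 <= a -> u >=v 0 -> a *: u >=v 0.
Proof. by move=> a0 /(vgeqqZ a0); rewrite scaler0. Qed.

Lemma vgeqq_subr_ge0 u v : (u - v >=v 0) <-> (u >=v v).
Proof. by split=> uv i; have := uv i; rewrite !mxE subr_ge0. Qed.

Lemma mulmx_vgeqq0 p (A : 'M[R]_(p, d)) u :
  (forall i j, 0 <= A i j) -> u >=v 0 -> A *m u >=v 0.
Proof.
move=> A0 u0 i; rewrite !mxE; apply: sumr_ge0 => j _.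
by apply: mulr_ge0 => //; have := u0 j; rewrite mxE.
Qed.

End OrderedVectors.

Lemma vgeqq_col_mx (R : realType) (m s : nat)
    (x x' : 'cV[R]_m) (y y' : 'cV[R]_s) :
  (col_mx (- x) y >=v col_mx (- x') y') <-> (x' >=v x) /\ (y >=v y').
Proof.
split=> [h | [hx hy] i].
  split=> i; first by have := h (lshift s i); rewrite !col_mxEu !mxE lerN2.
  by have := h (rshift m i); rewrite !col_mxEd.
by case: (split_ordP i) => j ->; rewrite ?col_mxEu ?col_mxEd ?mxE ?lerN2.
Qed.

Section DeletedColumn.
Variables (R : realType) (n : nat) (o : 'I_n).
Implicit Types (lambda : 'cV[R]_n) (mu : 'cV[R]_n.-1).

Lemma mulmx_col' m (A : 'M[R]_(m, n)) lambda :
  A *m lambda = lambda o 0 *: col o A + col' o A *m row' o lambda.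
Proof.
apply/colP => i; rewrite !mxE (bigD1_ord o) //= mulrC; congr (_ + _).
by apply: eq_bigr => j _; rewrite !mxE.
Qed.

Lemma sumv_row' lambda : sumv lambda = lambda o 0 + sumv (row' o lambda).
Proof.
rewrite /sumv (bigD1_ord o) //=; congr (_ + _).
by apply: eq_bigr => j _; rewrite mxE.
Qed.

(** Giving DMU_o weight zero turns weights on the remaining DMUs into weights on all of them, which
    is what [TDEA] quantifies over. *)
Definition extend0 mu : 'cV[R]_n := \col_i oapp (fun j => mu j 0) 0 (unlift o i).

Lemma extend0_o mu : extend0 mu o 0 = 0.
Proof. by rewrite mxE unlift_none. Qed.

Lemma row'_extend0 mu : row' o (extend0 mu) = mu.
Proof. by apply/colP => j; rewrite !mxE liftK. Qed.

Lemma mulmx_extend0 m (A : 'M[R]_(m, n)) mu : A *m extend0 mu = col' o A *m mu.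
Proof. by rewrite mulmx_col' extend0_o row'_extend0 scale0r add0r. Qed.

Lemma sumv_extend0 mu : sumv (extend0 mu) = sumv mu.
Proof. by rewrite sumv_row' extend0_o row'_extend0 add0r. Qed.

Lemma extend0_ge0 mu : mu >=v 0 -> extend0 mu >=v 0.
Proof.
move=> mu0 i; rewrite !mxE; case: unlift => //= j.
by have := mu0 j; rewrite mxE.
Qed.

End DeletedColumn.

Section Domination.
Variables (R : realType) (m s n : nat) (X : 'M[R]_(m, n)) (Y : 'M[R]_(s, n)).
Variable o : 'I_n.

(** The inequalities are homogeneous in [delta], so any positive total can be normalised to 1. This
    serves both the system, where the total is at least 1, and the weights left after deleting [o],
    where it is [1 - l o 0]. *)
Lemma dominated_by_remaining_cone (delta : 'cV[R]_n.-1) :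
  delta >=v 0 -> 0 < sumv delta ->
  sumv delta *: col o X >=v col' o X *m delta ->
  col' o Y *m delta >=v sumv delta *: col o Y ->
  dominated_by_remaining X Y o.
Proof.
move=> d0 s0 hX hY; exists ((sumv delta)^-1 *: delta).
have si0 : 0 <= (sumv delta)^-1 by rewrite invr_ge0 ltW.
have sK p (u : 'cV[R]_p) : (sumv delta)^-1 *: (sumv delta *: u) = u.
  by rewrite scalerA mulVf ?gt_eqF ?scale1r.
split.
- exact: vgeqqZ_ge0.
- by rewrite sumvZ mulVf // gt_eqF.
- by rewrite -[col o X]sK -scalemxAr; apply: vgeqqZ.
- by rewrite -[col o Y]sK -scalemxAr; apply: vgeqqZ.
Qed.

Lemma system_feasibleP :
  (exists (delta : 'cV[R]_n.-1) (tm : 'cV[R]_m) (tp : 'cV[R]_s),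
      (- (col' o X *m delta) + sumv delta *: col o X >=v tm) /\
      (col' o Y *m delta - sumv delta *: col o Y >=v tp) /\
      (1 <= sumv delta) /\
      (delta >=v 0) /\
      (ones >=v tm) /\ (tm >=v 0) /\
      (ones >=v tp) /\ (tp >=v 0)) <->
  dominated_by_remaining X Y o.
Proof.
have ones_ge0 d : @ones R d >=v 0 by move=> i; rewrite !mxE ler01.
split=> [[delta [tm [tp [hX [hY [s1 [d0 [_ [tm0 [_ tp0]]]]]]]]]]|].
  (* By transitivity through [tm >=v 0] and [tp >=v 0], the slacks drop out. *)
  apply: (@dominated_by_remaining_cone delta) => //.
  - exact: lt_le_trans s1.
  - by apply/vgeqq_subr_ge0; rewrite addrC; apply: vgeqq_trans tm0.
  - by apply/vgeqq_subr_ge0; apply: vgeqq_trans tp0.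
(* Zero slacks are admissible and leave exactly the two domination inequalities. *)
move=> [mu [mu0 s1 hX hY]]; exists mu, 0, 0; rewrite s1 !scale1r addrC.
by do !split=> //; apply/vgeqq_subr_ge0.
Qed.

Lemma convex_comb_dominated :
  convex_comb_of_remaining X Y o -> dominated_by_remaining X Y o.
Proof. by move=> [mu [mu0 s1 hX hY]]; exists mu; rewrite -hX -hY; split. Qed.

(** The dominating combination is itself a point of [TDEA], nonnegative data keeping it in the
    orthant. Either it differs from DMU_o and refutes efficiency, or it equals DMU_o and [mu] is a
    forbidden convex representation. *)
Lemma dominated_not_extreme :
  (forall i j, 0 <= X i j) -> (forall i j, 0 <= Y i j) ->
  dominated_by_remaining X Y o -> ~ extreme_efficient X Y o.
Proof.
move=> X0 Y0 [mu [mu0 s1 hX hY]] [eff nconv].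
have e0 := extend0_ge0 o mu0.
apply: eff; exists (X *m extend0 o mu), (Y *m extend0 o mu); split.
  split; [exact: mulmx_vgeqq0 | split; first exact: mulmx_vgeqq0].
  by exists (extend0 o mu); split; rewrite ?sumv_extend0.
rewrite !mulmx_extend0; split; first exact/vgeqq_col_mx.
by move=> /eq_col_mx [/oppr_inj eX eY]; apply: nconv; exists mu.
Qed.

Lemma not_dominated_strongly_efficient :
  ~ dominated_by_remaining X Y o -> strongly_efficient X Y o.
Proof.
move=> ndom [x [y [[_ [_ [l [hx hy s1 l0]]]] [/vgeqq_col_mx [ox oy] neq]]]].
have r0 : row' o l >=v 0 by move=> j; have := l0 (lift o j); rewrite !mxE.
have sE : sumv (row' o l) = 1 - l o 0.
  by rewrite -s1 (sumv_row' o) addrAC subrr add0r.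
have hX := vgeqq_trans ox hx; have hY := vgeqq_trans hy oy.
(* Either all the weight sits on [o], or the remaining DMUs carry a positive total. *)
have := sumv_ge0 r0; rewrite le_eqVlt => /orP[/eqP s0|s_gt0].
  have rE := sumv_eq0 r0 (esym s0).
  have lo : l o 0 = 1 by apply/esym/eqP; rewrite -subr_eq0 -sE -s0.
  (* Now [X *m l] and [Y *m l] are the data of DMU_o, so antisymmetry forces [x] and [y] to equal
     them, against [neq]. *)
  move: hx hy; rewrite !(mulmx_col' o) rE lo !mulmx0 !addr0 !scale1r => hx hy.
  by apply: neq; rewrite (vgeqq_anti ox hx) (vgeqq_anti oy hy).
apply/ndom/(dominated_by_remaining_cone r0 s_gt0); apply/vgeqq_subr_ge0.
  (* With [r] for [row' o l], [(1 - l o 0) *: col o X - col' o X *m r] regroups as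
     [col o X - X *m l]; the outputs are similar. *)
  rewrite sE scalerBl scale1r -addrA -opprD -mulmx_col'.
  exact/vgeqq_subr_ge0.
rewrite sE scalerBl scale1r opprB addrCA addrA -mulmx_col'.
exact/vgeqq_subr_ge0.
Qed.

End Domination.

Theorem corollary3p1 (R : realType) (m s n : nat)
    (X : 'M[R]_(m, n)) (Y : 'M[R]_(s, n))
    (X_ge0 : forall i j, 0 <= X i j) (Y_ge0 : forall i j, 0 <= Y i j)
    (o : 'I_n) :
  extreme_efficient X Y o <->
  ~ exists (delta : 'cV[R]_n.-1) (tm : 'cV[R]_m) (tp : 'cV[R]_s),
      (- (col' o X *m delta) + sumv delta *: col o X >=v tm) /\
      (col' o Y *m delta - sumv delta *: col o Y >=v tp) /\
      (1 <= sumv delta) /\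
      (delta >=v 0) /\
      (ones >=v tm) /\ (tm >=v 0) /\
      (ones >=v tp) /\ (tp >=v 0).
Proof.
split=> [ext /system_feasibleP dom|infeas].
  exact: dominated_not_extreme dom ext.
have ndom : ~ dominated_by_remaining X Y o by move/system_feasibleP.
split; first exact: not_dominated_strongly_efficient.
by move/convex_comb_dominated.
Qed.
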